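(* Let $N\geq 1$, let $m_I,m_E\geq 0$ be integers with $m=m_I+m_E\geq 1$, and let $q_i(x)=x^\top A_i x+2b_i^\top x+c_i$ ($i=0,\dots,m$) be quadratic functions on $\mathbb{R}^N$ with $A_i\in\mathbb{S}^N$, $b_i\in\mathbb{R}^N$, $c_i\in\mathbb{R}$. Let $\mathcal{D}$, $\mathcal{D}_{\mathrm{SDP}}$, $\Gamma$, $A(\gamma)$, $b(\gamma)$, semidefinite faces and $\mathcal{V}(\mathcal{F})$ be as defined in the context. Suppose that: (1) the set $\{x\in\mathbb{R}^N : q_i(x)\leq 0 \text{ for } i=1,\dots,m_I,\ q_i(x)=0 \text{ for } i=m_I+1,\dots,m\}$ is nonempty, and there exists $\gamma^*\in\mathbb{R}^m$ with $\gamma^*_i\geq 0$ for all $i=1,\dots,m_I$ and $A_0+\sum_{i=1}^m\gamma_i^*A_i\succ 0$; (2) $\Gamma$ is polyhedral. If for every semidefinite face $\mathcal{F}$ of $\Gamma$ we have $$\dim(\mathcal{V}(\mathcal{F}))\geq \operatorname{aff\,dim}(\{b(\gamma):\gamma\in\mathcal{F}\})+1,$$ then $\operatorname{conv}(\mathcal{D})=\mathcal{D}_{\mathrm{SDP}}$.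
   Context: $\mathbb{S}^N$ denotes the real symmetric $N\times N$ matrices; $\operatorname{conv}$ is the convex hull; $\operatorname{aff\,dim}$ is the affine dimension (dimension of the affine hull). Epigraph of the QCQP: $\mathcal{D}=\{(x,t)\in\mathbb{R}^N\times\mathbb{R} : q_0(x)\leq 2t,\ q_i(x)\leq 0\ (1\leq i\leq m_I),\ q_i(x)=0\ (m_I+1\leq i\leq m)\}$. Projected epigraph of the SDP relaxation: let $Q_i=\begin{pmatrix}c_i & b_i^\top\\ b_i & A_i\end{pmatrix}\in\mathbb{S}^{N+1}$. Then $\mathcal{D}_{\mathrm{SDP}}$ is the set of $(x,t)\in\mathbb{R}^{N+1}$ for which there exists $X\in\mathbb{S}^N$ such that $Y=\begin{pmatrix}1&x^\top\\ x&X\end{pmatrix}$ satisfies $Y\succeq 0$, $\langle Q_0,Y\rangle\leq 2t$, $\langle Q_i,Y\rangle\leq 0$ for $1\leq i\leq m_I$, and $\langle Q_i,Y\rangle=0$ for $m_I+1\leq i\leq m$. For $\gamma\in\mathbb{R}^m$: $A(\gamma)=A_0+\sum_{i=1}^m\gamma_iA_i$ and $b(\gamma)=b_0+\sum_{i=1}^m\gamma_ib_i$. The dual object is $\Gamma=\{\gamma\in\mathbb{R}^m : A(\gamma)\succeq 0,\ \gamma_i\geq 0\ (1\leq i\leq m_I)\}$. A face $\mathcal{F}$ of $\Gamma$ is definite if there exists $\gamma\in\mathcal{F}$ with $A(\gamma)\succ 0$; otherwise it is semidefinite, and $\mathcal{V}(\mathcal{F})=\{v\in\mathbb{R}^N :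 A(\gamma)v=0\ \forall\gamma\in\mathcal{F}\}$. *)

(* Defs.v *)
From HB Require Import structures.
From mathcomp Require Import all_boot all_order all_algebra.
From mathcomp Require Import boolp classical_sets reals convex.

Set Implicit Arguments.
Unset Strict Implicit.
Unset Printing Implicit Defensive.

Import Order.TTheory GRing.Theory Num.Theory.

Local Open Scope classical_set_scope.
Local Open Scope ring_scope.

(* Conventions: vectors are column vectors, and R^N * R is ['cV[R]_N * R^o]. *)

Section Convexity.
Context {R : realType} {V : lmodType R}.
Implicit Types (C F S : set V).

Definition convex_hull S : set V := smallest (@convex_set R V) S.

(* As usual in convex analysis, both [C] and the empty set are faces of [C]. *)
Definition face C F : Prop :=
  [/\ convex_set (F : set (convex_lmodType V)), F `<=` C &
      forall (x y : V) (t : R), C x -> C y -> 0 < t < 1 ->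
        F (t *: x + (1 - t) *: y) -> F x /\ F y].

Definition affine_hull S : set V :=
  [set y | exists k (w : 'I_k -> R) (p : 'I_k -> V),
     [/\ forall i, S (p i), \sum_i w i = 1 & y = \sum_i w i *: p i]].

End Convexity.

Definition polyhedral {R : realType} {n : nat} (C : set 'cV[R]_n) : Prop :=
  exists k (M : 'M[R]_(k, n)) (d : 'cV[R]_k),
    C = [set x | forall i, (M *m x) i 0 <= d i 0].

Section Dimension.
Context {R : realType} {V : vectType R}.

(* Largest size of a free family of elements of [U]; this is meant for sets
   [U] that are linear subspaces, see [subspace_dim_vspace]. *)
Definition subspace_dim (U : set V) : nat :=
  \max_(k < (\dim {:V}).+1 |
    `[< exists s : k.-tuple V, free s /\ forall v, v \in s -> U v >]) k.

Lemma subspace_dim_vspace (U : {vspace V}) :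
  subspace_dim [set v | v \in U] = \dim U.
Proof.
apply/eqP; rewrite eqn_leq; apply/andP; split.
  apply/bigmax_leqP => k /asboolP[s [fs sU]].
  rewrite -(size_tuple s) -(eqP fs); apply: dimvS.
  by apply/span_subvP => v /sU.
have dU : (\dim U < (\dim {:V}).+1)%N by rewrite ltnS dimvS ?subvf.
apply: (@leq_bigmax_cond _ _ _ (Ordinal dU)).
apply/asboolP; exists (vbasis U); split; first exact: basis_free (vbasisP U).
by move=> v /vbasis_mem.
Qed.

(* Dimension of the direction space of the affine hull, and -1 for the empty
   set. *)
Definition affdim (S : set V) : int :=
  if `[< S = set0 >] then -1
  else (subspace_dim
    [set p.1 - p.2 | p in affine_hull S `*` affine_hull S])%:Z.

End Dimension.

Section PositiveMatrices.
Context {R : realType} {n : nat}.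
Implicit Types A B : 'M[R]_n.

Definition mxinner A B : R := \tr (A^T *m B).

Definition psdmx A : Prop :=
  A^T = A /\ forall x : 'cV[R]_n, 0 <= (x^T *m A *m x) 0 0.

Definition pdmx A : Prop :=
  A^T = A /\ forall x : 'cV[R]_n, x != 0 -> 0 < (x^T *m A *m x) 0 0.

End PositiveMatrices.

(* The quadratic function x |-> x^T A x + 2 b^T x + c. *)
Record quadratic (R : realType) (N : nat) := Quadratic {
  quadA : 'M[R]_N;
  quadb : 'cV[R]_N;
  quadc : R;
  quadA_sym : quadA^T = quadA }.

Definition quad_eval {R : realType} {N : nat} (q : quadratic R N)
    (x : 'cV[R]_N) : R :=
  (x^T *m quadA q *m x) 0 0 + 2 * ((quadb q)^T *m x) 0 0 + quadc q.

Definition quad_mx {R : realType} {N : nat} (q : quadratic R N) :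
    'M[R]_(1 + N) :=
  block_mx (quadc q)%:M (quadb q)^T (quadb q) (quadA q).

Section QCQP.
Context {R : realType} {N mI mE : nat}.
(* Constraints with index [lshift mE i] are inequalities, those with index
   [rshift mI j] are equations. *)
Variables (q0 : quadratic R N) (q : 'I_(mI + mE) -> quadratic R N).
Implicit Types (gamma : 'cV[R]_(mI + mE)) (F : set 'cV[R]_(mI + mE)).

Definition feasible : set 'cV[R]_N :=
  [set x | (forall i : 'I_mI, quad_eval (q (lshift mE i)) x <= 0) /\
           (forall j : 'I_mE, quad_eval (q (rshift mI j)) x = 0)].

Definition epigraph : set ('cV[R]_N * R^o) :=
  [set xt | quad_eval q0 xt.1 <= 2 * xt.2 /\ feasible xt.1].

Definition sdp_epigraph : set ('cV[R]_N * R^o) :=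
  [set xt | exists X : 'M[R]_N,
     X^T = X /\
     let Y : 'M[R]_(1 + N) := block_mx 1%:M (xt.1)^T xt.1 X in
     [/\ psdmx Y,
         mxinner (quad_mx q0) Y <= 2 * xt.2,
         forall i : 'I_mI, mxinner (quad_mx (q (lshift mE i))) Y <= 0 &
         forall j : 'I_mE, mxinner (quad_mx (q (rshift mI j))) Y = 0]].

Definition aggA gamma : 'M[R]_N :=
  quadA q0 + \sum_i gamma i 0 *: quadA (q i).

Definition aggb gamma : 'cV[R]_N :=
  quadb q0 + \sum_i gamma i 0 *: quadb (q i).

Definition ineq_nonneg gamma : Prop :=
  forall i : 'I_mI, 0 <= gamma (lshift mE i) 0.

Definition dual_set : set 'cV[R]_(mI + mE) :=
  [set gamma | psdmx (aggA gamma) /\ ineq_nonneg gamma].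

Definition definite F : Prop := exists2 gamma, F gamma & pdmx (aggA gamma).

Definition semidefinite_face F : Prop := face dual_set F /\ ~ definite F.

Definition common_kernel F : set 'cV[R]_N :=
  [set v | forall gamma, F gamma -> aggA gamma *m v = 0].

End QCQP.

(* Main.v *)
(* By weak duality, the Lagrangian is nonpositive on Gamma at every point (x, t)
   of the relaxation. As Gamma is polyhedral, the cone over Gamma * {1} has
   finitely many generators, so this says that finitely many convex quadratic
   functions of x are at most affine functions of t. Lower t until one of them
   is active: the maximizers of the Lagrangian then form a nonempty face F of
   Gamma. If F is definite, complementary slackness puts (x, t) in the epigraph.
   Otherwise the dimension hypothesis gives a nonzero v in V(F) on which b is
   constant over F; along the line through (x, t) with direction (v, b.v) the
   active functions stay active, while a definite gamma in Gamma forces another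
   one to become active in both directions. So (x, t) is a convex combination of
   two points with more active functions, and induction applies. *)
Require Import Defs.
From HB Require Import structures.
From mathcomp Require Import all_boot all_order all_algebra.
From mathcomp Require Import ring lra.
From mathcomp Require Import boolp classical_sets reals convex.
From mathcomp Require Import interval_inference.

Set Implicit Arguments.
Unset Strict Implicit.
Unset Printing Implicit Defensive.

Import Order.TTheory GRing.Theory Num.Theory.
Local Open Scope classical_set_scope.
Local Open Scope ring_scope.

(** * Convex sets through explicit weights *)

Section ConvexSets.
Context {R : realType} {V : lmodType R}.
Implicit Types C : set V.

Lemma convex_setP C : convex_set (C : set (convex_lmodType V)) <->
  forall x y (t : R), 0 < t < 1 -> C x -> C y -> C (t *: x + (1 - t) *: y).
Proof.
split=> [cC x y t /andP[t0 t1] Cx Cy|cC].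
  have it : Itv.spec (@Itv.num_sem R) (Itv.Real `[0%Z, 1%Z]) t.
    by apply/andP; split; rewrite ?num_real//= in_itv/= (ltW t0) (ltW t1).
  have /= := cC x y (Itv.mk it).
  by rewrite !inE; apply.
apply/convex_setW => x y; rewrite !inE => Cx Cy k k0 k1; rewrite inE.
by apply: cC => //; rewrite k0 k1.
Qed.

End ConvexSets.

(** * Finitely generated cones and linear inequalities *)

Section Cones.
Context {R : realFieldType} {V : lmodType R}.

Definition in_cone (I : finType) (g : I -> V) (z : V) : Prop :=
  exists2 c : I -> R, forall i, 0 <= c i & z = \sum_i c i *: g i.

Section Closure.
Variables (I : finType) (g : I -> V).

Lemma in_coneD x y : in_cone g x -> in_cone g y -> in_cone g (x + y).
Proof.
move=> [c c0 ->] [e e0 ->]; exists (fun i => c i + e i) => [i|].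
  exact: addr_ge0.
by rewrite -big_split; apply: eq_bigr => i _; rewrite scalerDl.
Qed.

Lemma in_coneZ a x : 0 <= a -> in_cone g x -> in_cone g (a *: x).
Proof.
move=> a0 [c c0 ->]; exists (fun i => a * c i) => [i|]; first exact: mulr_ge0.
by rewrite scaler_sumr; apply: eq_bigr => i _; rewrite scalerA.
Qed.

Lemma in_cone0 : in_cone g 0.
Proof. by exists (fun=> 0) => //; rewrite big1// => i _; rewrite scale0r. Qed.

Lemma in_cone_gen i : in_cone g (g i).
Proof.
exists (fun j => (j == i)%:R) => [j|]; first by rewrite ler0n.
rewrite (bigD1 i)//= eqxx scale1r big1 ?addr0// => j /negPf->.
by rewrite scale0r.
Qed.

Lemma in_cone_sum (J : finType) (P : pred J) (c : J -> R) (h : J -> V) :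
  (forall j, P j -> 0 <= c j) -> (forall j, P j -> in_cone g (h j)) ->
  in_cone g (\sum_(j | P j) c j *: h j).
Proof.
move=> c0 gh; apply: big_ind => [||j Pj]; [exact: in_cone0|exact: in_coneD|].
by apply: in_coneZ; [exact: c0|exact: gh].
Qed.

End Closure.

(* One step of the double description method: keep the generators in the half
   space, and add for each pair of generators strictly on opposite sides the
   combination that lies on the hyperplane. *)
Lemma cone_halfspace (I : finType) (g : I -> V) (a : {scalar V}) :
  exists (J : finType) (h : J -> V),
    forall z, in_cone h z <-> in_cone g z /\ a z <= 0.
Proof.
(* Discarded generators and pairs are sent to 0, which adds nothing to the cone, so the index type
   does not depend on signs. *)
pose h (k : I + I * I) : V := match k with
  | inl i => if a (g i) <= 0 then g i else 0
  | inr (i, j) => if (0 < a (g i)) && (a (g j) < 0)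
                  then a (g i) *: g j - a (g j) *: g i else 0
  end.
exists (I + I * I)%type, h => z; split.
  move=> [c c0 ->]; split.
    apply: in_cone_sum => // -[i|[i j]] _ /=.
      by case: ifP => _; [exact: in_cone_gen|exact: in_cone0].
    case: ifP => [/andP[i0 j0]|_]; last exact: in_cone0.
    rewrite -scaleNr; apply: in_coneD.
      by apply: in_coneZ; [exact: ltW|exact: in_cone_gen].
    by apply: in_coneZ; [rewrite oppr_ge0 ltW|exact: in_cone_gen].
  rewrite linear_sum; apply: sumr_le0 => k _; rewrite linearZ /=.
  apply: mulr_ge0_le0 => //; case: k => [i|[i j]] /=.
    by case: ifP => //; rewrite linear0.
  case: ifP; last by rewrite linear0.
  by move=> _; rewrite linearB !linearZ /= mulrC subrr.
move=> [[c c0 ->] az].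
have hl i : a (g i) <= 0 -> in_cone h (g i).
  by move=> i0; have := in_cone_gen h (inl i); rewrite /= i0.
have hr i j : 0 < a (g i) -> a (g j) < 0 ->
    in_cone h (a (g i) *: g j - a (g j) *: g i).
  by move=> i0 j0; have := in_cone_gen h (inr (i, j)); rewrite /= i0 j0.
pose P := \sum_(i | 0 < a (g i)) c i * a (g i).
pose M := \sum_(i | ~~ (0 < a (g i))) c i * a (g i).
have PM : P + M <= 0.
  move: az; rewrite linear_sum (bigID (fun i => 0 < a (g i))) /=.
  by congr (_ + _ <= _); apply: eq_bigr => i _; rewrite linearZ.
have P0 : 0 <= P by apply: sumr_ge0 => i /ltW; exact: mulr_ge0.
rewrite (bigID (fun i => 0 < a (g i))) /=.
have [PE|Pn0] := eqVneq P 0.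
  rewrite big1 ?add0r => [|i i0].
    by apply: in_cone_sum => // i; rewrite -leNgt; exact: hl.
  have /eqP := PE; rewrite psumr_eq0 => [/allP/(_ i)|j /ltW]; last first.
    exact: mulr_ge0.
  rewrite mem_index_enum i0 mulf_eq0 (gt_eqF i0) orbF => /(_ isT)/eqP->.
  exact: scale0r.
have Pgt0 : 0 < P by rewrite lt_def Pn0.
have Mlt0 : M < 0 by lra.
have Mn0 : M != 0 by rewrite lt_eqF.
(* Each positive generator is paired with all the others in proportion to their weights. This uses
   up the fraction [- P / M] of the nonpositive part; the fraction [(P + M) / M >= 0] is left
   over. *)
have -> : \sum_(i | 0 < a (g i)) c i *: g i +
          \sum_(i | ~~ (0 < a (g i))) c i *: g i =
    \sum_(i | 0 < a (g i)) (c i / - M) *: \sum_(j | ~~ (0 < a (g j)))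
      c j *: (a (g i) *: g j - a (g j) *: g i) +
    \sum_(i | ~~ (0 < a (g i))) (c i * ((P + M) / M)) *: g i.
  have -> : \sum_(i | ~~ (0 < a (g i))) (c i * ((P + M) / M)) *: g i =
      ((P + M) / M) *: \sum_(i | ~~ (0 < a (g i))) c i *: g i.
    rewrite scaler_sumr; apply: eq_bigr => i _.
    by rewrite scalerA mulrC.
  have inner i : \sum_(j | ~~ (0 < a (g j)))
        c j *: (a (g i) *: g j - a (g j) *: g i) =
      a (g i) *: \sum_(j | ~~ (0 < a (g j))) c j *: g j - M *: g i.
    rewrite scaler_sumr scaler_suml -sumrB; apply: eq_bigr => j _.
    by rewrite scalerBr !scalerA mulrC.
  under [X in _ = X + _]eq_bigr => i _.
    rewrite inner scalerBr !scalerA.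
    have -> : c i / - M * M = - c i by field; exact: Mn0.
    rewrite scaleNr opprK.
    over.
  rewrite big_split /= -scaler_suml addrAC addrC; congr (_ + _).
  rewrite -scalerDl -[LHS]scale1r; congr (_ *: _).
  have -> : \sum_(i | 0 < a (g i)) c i / - M * a (g i) = P / - M.
    by rewrite /P mulr_suml; apply: eq_bigr => i _; rewrite mulrAC.
  by field; exact: Mn0.
apply: in_coneD; apply: in_cone_sum => i i0.
- by apply: mulr_ge0 => //; rewrite invr_ge0 oppr_ge0 ltW.
(* For [g j] on the hyperplane itself, the pair combination is just a multiple of [g j]. *)
- apply: in_cone_sum => // j; rewrite -leNgt le_eqVlt => /orP[/eqP j0|].
    rewrite j0 scale0r subr0; apply: in_coneZ; first exact: ltW.
    by apply: hl; rewrite j0.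
  exact: hr.
- by apply: mulr_ge0 => //; rewrite mulr_le0// invr_le0 ltW.
- by apply: hl; rewrite leNgt.
Qed.

End Cones.

(** One half of the Minkowski-Weyl theorem: start from the whole space, generated by a basis and its
    negatives, and cut by one half space at a time. *)
Lemma cone_polyhedral (R : realFieldType) (V : vectType R)
    (s : seq {scalar V}) :
  exists (J : finType) (h : J -> V),
    forall z, in_cone h z <-> all (fun a : {scalar V} => a z <= 0) s.
Proof.
elim: s => [|a s [I [g gP]]].
  pose g (k : 'I_(\dim {:V}) * bool) : V :=
    (-1) ^+ k.2 *: (vbasis {:V})`_k.1.
  exists ('I_(\dim {:V}) * bool)%type, g => z; split=> // _.
  rewrite (coord_vbasis (memvf z)).
  rewrite -[X in in_cone g X]/(\sum_(i < _ | true) _).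
  elim/big_ind: _ => [||i _]; [exact: in_cone0|exact: in_coneD|].
  have [c0|/ltW c0] := leP 0 (coord (vbasis {:V}) i z).
    have := in_coneZ c0 (in_cone_gen g (i, false)).
    by rewrite /g /= expr0 scale1r.
  rewrite -oppr_ge0 in c0; have := in_coneZ c0 (in_cone_gen g (i, true)).
  by rewrite /g /= expr1 scaleN1r scalerN scaleNr opprK.
have [J [h hP]] := cone_halfspace g a; exists J, h => z.
by rewrite hP gP /=; split=> [[-> ->]|/andP[-> ->]].
Qed.

(** * Bilinear forms and positive matrices *)

Section Forms.
Context {R : realType} {n : nat}.
Implicit Types (A B : 'M[R]_n) (x y u v : 'cV[R]_n).

Definition bform A x y : R := (x^T *m A *m y) 0 0.

Lemma bformDl A x y z : bform A (x + y) z = bform A x z + bform A y z.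
Proof. by rewrite /bform linearD /= !mulmxDl mxE. Qed.

Lemma bformDr A x y z : bform A x (y + z) = bform A x y + bform A x z.
Proof. by rewrite /bform mulmxDr mxE. Qed.

Lemma bformZl A a x y : bform A (a *: x) y = a * bform A x y.
Proof. by rewrite /bform linearZ /= -!scalemxAl mxE. Qed.

Lemma bformZr A a x y : bform A x (a *: y) = a * bform A x y.
Proof. by rewrite /bform -scalemxAr mxE. Qed.

Lemma bformC A x y : A^T = A -> bform A x y = bform A y x.
Proof.
move=> sA; have -> : bform A x y = (y^T *m A *m x)^T 0 0.
  by rewrite !trmx_mul trmxK sA mulmxA.
by rewrite mxE.
Qed.

Lemma bform_addmx A B x y : bform (A + B) x y = bform A x y + bform B x y.
Proof. by rewrite /bform mulmxDr mulmxDl mxE. Qed.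

Lemma bform_scalemx a A x y : bform (a *: A) x y = a * bform A x y.
Proof. by rewrite /bform -scalemxAr -scalemxAl mxE. Qed.

Lemma bform0 x y : bform 0 x y = 0.
Proof. by rewrite /bform mulmx0 mul0mx mxE. Qed.

Lemma bform_sum I (r : seq I) (F : I -> 'M[R]_n) x y :
  bform (\sum_(i <- r) F i) x y = \sum_(i <- r) bform (F i) x y.
Proof.
by elim/big_rec2: _ => [|i a A _ <-]; rewrite ?bform0 ?bform_addmx.
Qed.

Lemma bform_coord A x y : bform A x y = \sum_i \sum_j x i 0 * A i j * y j 0.
Proof.
rewrite /bform mxE exchange_big; apply: eq_bigr => j _ /=.
by rewrite mxE mulr_suml; apply: eq_bigr => i _; rewrite mxE.
Qed.

Lemma bform_line A x v a : A^T = A ->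
  bform A (x + a *: v) (x + a *: v) =
  bform A x x + 2 * a * bform A v x + a ^+ 2 * bform A v v.
Proof.
move=> sA; rewrite !(bformDl, bformDr, bformZl, bformZr) (bformC x v sA); ring.
Qed.

Lemma psdmxD A B : psdmx A -> psdmx B -> psdmx (A + B).
Proof.
move=> [sA pA] [sB pB]; split=> [|x]; first by rewrite linearD /= sA sB.
by rewrite -/(bform _ _ _) bform_addmx addr_ge0 ?pA ?pB.
Qed.

Lemma psdmxZ a A : 0 <= a -> psdmx A -> psdmx (a *: A).
Proof.
move=> a0 [sA pA]; split=> [|x]; first by rewrite linearZ /= sA.
by rewrite -/(bform _ _ _) bform_scalemx mulr_ge0 ?pA.
Qed.

Lemma pdmxW A : pdmx A -> psdmx A.
Proof.
move=> [sA pA]; split=> // x; have [->|/pA/ltW//] := eqVneq x 0.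
by rewrite mulmx0 mxE.
Qed.

Lemma ge0_ray (a b : R) : (forall s, 0 <= s -> 0 <= a + s * b) -> 0 <= b.
Proof.
move=> ab; rewrite leNgt; apply/negP => b0.
have a0 : 0 <= a by have := ab 0 (lexx 0); rewrite mul0r addr0.
(* This [s] is chosen so that the affine function takes the value -1. *)
have : 0 <= a + (a + 1) / - b * b.
  by apply: ab; apply: divr_ge0; lra.
have -> : a + (a + 1) / - b * b = - 1 by field; rewrite lt_eqF.
by lra.
Qed.

(** Recession directions of the semidefinite cone lie in it: for each [x] the form is affine in [s],
    and [ge0_ray] applies. *)
Lemma psdmx_ray A B : (forall s, 0 <= s -> psdmx (A + s *: B)) -> psdmx B.
Proof.
move=> AB; have sA : A^T = A by have [] := AB 0 (lexx 0); rewrite scale0r addr0.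
split=> [|x].
  have [] := AB 1 ler01; rewrite scale1r linearD /= sA.
  by move/addrI.
apply: (@ge0_ray (bform A x x)) => s s0; have [_ /(_ x)] := AB s s0.
by rewrite -/(bform _ _ _) bform_addmx bform_scalemx.
Qed.

Lemma psdmx_cauchy A x y : psdmx A ->
  bform A x y ^+ 2 <= bform A x x * bform A y y.
Proof.
move=> [sA pA]; have key s t : 0 <= s ^+ 2 * bform A x x +
    2 * s * t * bform A x y + t ^+ 2 * bform A y y.
  have := pA (s *: x + t *: y); rewrite -/(bform _ _ _).
  by rewrite !(bformDl, bformDr, bformZl, bformZr) (bformC y x sA); lra.
have x0 : 0 <= bform A x x := pA x.
have y0 : 0 <= bform A y y := pA y.
move: (bform A x x) (bform A x y) (bform A y y) x0 y0 key => a b c a0 c0 key.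
have [ae|an0] := eqVneq a 0.
  rewrite ae mul0r in key *; have [->|bn0] := eqVneq b 0.
    by rewrite expr0n.
  (* With [a = 0] and [b != 0], this choice gives the form the value -1. *)
  have := key (- (c + 1) / (2 * b)) 1.
  rewrite expr1n mulr1 mul1r mulr0 add0r.
  have -> : 2 * (- (c + 1) / (2 * b)) * b = - (c + 1) by field.
  by lra.
have agt0 : 0 < a by rewrite lt_def an0.
have := key (- b) a.
have -> : (- b) ^+ 2 * a + 2 * - b * a * b + a ^+ 2 * c = a * (a * c - b ^+ 2).
  by ring.
by rewrite pmulr_rge0// subr_ge0.
Qed.

Lemma pdmx_unit A : pdmx A -> A \in unitmx.
Proof.
move=> [sA pA]; rewrite -row_free_unit -kermx_eq0.
apply: contraT => /rowV0Pn[u /sub_kermxP uA un0].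
have /pA : u^T != 0 by rewrite -[X in _ != X]trmx0 (inj_eq trmx_inj).
by rewrite trmxK uA mul0mx mxE ltxx.
Qed.

(** The coordinate [x i 0] is the [A]-inner product of [x] with the [i]-th column of the inverse of
    [A], so Cauchy-Schwarz bounds it; summing the constants serves all [i] at once. *)
Lemma pdmx_coord_bound A : pdmx A ->
  exists2 c, 0 <= c & forall x i, x i 0 ^+ 2 <= c * bform A x x.
Proof.
move=> pA; have [sA pA0] := pdmxW pA; have Au := pdmx_unit pA.
pose u i := invmx A *m (delta_mx i 0 : 'cV[R]_n).
have ux i x : bform A (u i) x = x i 0.
  rewrite bformC// /bform -mulmxA mulKVmx//.
  rewrite mxE (bigD1 i)//= !mxE !eqxx mulr1 big1 ?addr0// => j /negPf ji.
  by rewrite !mxE ji mulr0.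
exists (\sum_i bform A (u i) (u i)) => [|x i].
  by apply: sumr_ge0 => i _; exact: pA0.
rewrite -ux; apply: le_trans (psdmx_cauchy _ _ (pdmxW pA)) _.
rewrite ler_wpM2r ?pA0// (bigD1 i)//= lerDl.
by apply: sumr_ge0 => j _; exact: pA0.
Qed.

Lemma pdmx_open A B : pdmx A -> B^T = B ->
  exists2 e, 0 < e & forall s, 0 <= s <= e -> psdmx (A + s *: B).
Proof.
move=> pA sB; have [c c0 cP] := pdmx_coord_bound pA.
have [sA pA0] := pdmxW pA.
pose b := \sum_i \sum_j `|B i j|.
have b0 : 0 <= b by apply: sumr_ge0 => i _; exact: sumr_ge0.
have bP x : - (b * (c * bform A x x)) <= bform B x x.
  rewrite [leRHS]bform_coord mulr_suml -sumrN; apply: ler_sum => i _.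
  rewrite mulr_suml -sumrN; apply: ler_sum => j _.
  rewrite lerNl -mulrN; apply: le_trans (ler_norm _) _.
  rewrite normrM normrN normrM mulrAC mulrC ler_wpM2l//.
  have := cP x i; have := cP x j; rewrite -normrM.
  (* The product of two coordinates is at most the mean of their squares. *)
  have : 0 <= (`|x i 0| - `|x j 0|) ^+ 2 by exact: sqr_ge0.
  rewrite sqrrB !real_normK ?num_real// normrM; lra.
(* The form of [B] is at least [- b * c] times that of [A], and this bound on [s] gives
   [s * b * c <= 1]; the [+ 1] keeps the denominator positive. *)
have e0 : 0 < (b * c + 1)^-1 by rewrite invr_gt0 ltr_wpDl// mulr_ge0.
exists (b * c + 1)^-1 => // s /andP[s0 se]; split=> [|x].
  by rewrite linearD linearZ /= sA sB.
rewrite -/(bform _ _ _) bform_addmx bform_scalemx.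
have X0 : 0 <= bform A x x := pA0 x.
have : s * - (b * (c * bform A x x)) <= s * bform B x x by rewrite ler_wpM2l.
have : (b * c + 1) * s <= 1.
  by rewrite -ler_pdivlMl ?mulr1// -invr_gt0.
have : 0 <= s * bform A x x by exact: mulr_ge0.
nra.
Qed.

End Forms.

(** * Schur complements, Cholesky factors and the trace inner product *)

Lemma bform_block (R : realType) (n : nat) (a s : R) (w y : 'cV[R]_n)
    (S : 'M[R]_n) :
  bform (block_mx a%:M w^T w S) (col_mx s%:M y) (col_mx s%:M y) =
  s ^+ 2 * a + 2 * s * (w^T *m y) 0 0 + bform S y y.
Proof.
rewrite /bform tr_col_mx mul_row_block mul_row_col !mulmxDl tr_scalar_mx.
rewrite !mul_scalar_mx -!scalemxAl -!scalar_mxM mul_mx_scalar.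
have -> : y^T *m w = (w^T *m y)^T by rewrite trmx_mul trmxK.
rewrite !mxE /= mulr1n; ring.
Qed.

(** For fixed [y], minimizing the block form over its first coordinate leaves the form of the Schur
    complement at [y]. *)
Lemma psdmx_schur (R : realType) (n : nat) (a : R) (w : 'cV[R]_n)
    (S : 'M[R]_n) :
  0 < a -> psdmx (block_mx a%:M w^T w S) ->
  psdmx (S - a^-1 *: (w *m w^T)).
Proof.
move=> a0 [sZ Z0].
have sS : S^T = S by move: sZ; rewrite tr_block_mx => /eq_block_mx[].
split=> [|y].
  by rewrite linearB linearZ /= sS trmx_mul trmxK.
have := Z0 (col_mx (- a^-1 * (w^T *m y) 0 0)%:M y).
rewrite -/(bform _ _ _) bform_block.
have -> : (y^T *m (S - a^-1 *: (w *m w^T)) *m y) 0 0 =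
    bform S y y - a^-1 * (w^T *m y) 0 0 ^+ 2.
  rewrite -/(bform _ _ _) bform_addmx -scaleNr bform_scalemx mulNr.
  congr (_ - _ * _); rewrite /bform mulmxA -mulmxA mxE big_ord1 expr2.
  by congr (_ * _); rewrite -[w in LHS]trmxK -trmx_mul mxE.
move: (bform _ _ _) ((_ *m _) 0 0) => f c; congr (0 <= _); field.
by rewrite gt_eqF.
Qed.

(** Induction on the size: a positive pivot passes to the Schur complement, and a zero pivot forces
    the rest of its column to vanish. *)
Lemma psdmx_cholesky (R : realType) (n : nat) (Z : 'M[R]_n) :
  psdmx Z -> exists L : 'M[R]_n, Z = L *m L^T.
Proof.
elim: n Z => [|n IH] Z.
  by exists 0; apply/matrixP => - [].
rewrite -[n.+1]/(1 + n)%N in Z *; move=> pZ.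
have [sZ Z0] := pZ.
pose a := Z 0 0; pose w : 'cV[R]_n := dlsubmx Z; pose S := drsubmx Z.
have ZE : Z = block_mx a%:M w^T w S.
  rewrite -[LHS]submxK; congr block_mx.
    rewrite [LHS]mx11_scalar !mxE; congr (_ %:M).
    by congr (Z _ _); exact/val_inj.
  by rewrite /w -[in RHS]sZ; apply/matrixP => i j; rewrite !mxE.
have sS : S^T = S.
  by apply/matrixP => i j; rewrite /S -[in RHS]sZ !mxE.
have pB : psdmx (block_mx a%:M w^T w S) by rewrite -ZE.
have fZ (s : R) y : 0 <= s ^+ 2 * a + 2 * s * (w^T *m y) 0 0 + bform S y y.
  by rewrite -bform_block; case: pB => _; apply.
have a0 : 0 <= a.
  by have := fZ 1 0; rewrite mulmx0 /bform mulmx0 !mxE; lra.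
have [ae|an0] := eqVneq a 0.
  (* At [(s, - w)] the form is affine in [s] with slope minus twice the squared norm of [w], so this
     slope cannot be negative. *)
  have w0 : w = 0.
    have : 0 <= 2 * (w^T *m - w) 0 0.
      apply: (@ge0_ray _ (bform S (- w) (- w))) => s _.
      by have := fZ s (- w); rewrite ae; lra.
    rewrite mulmxN !mxE pmulr_rge0// oppr_ge0 => w_le0.
    have w_ge0 i : true -> 0 <= w^T 0 i * w i 0.
      by rewrite mxE -expr2 sqr_ge0.
    have /eqP : \sum_i w^T 0 i * w i 0 = 0.
      by apply/le_anti; rewrite w_le0 sumr_ge0.
    rewrite psumr_eq0// => /allP w0; apply/matrixP => i j.
    rewrite ord1 [RHS]mxE; have := w0 i.
    by rewrite mem_index_enum [w^T _ _]mxE mulf_eq0 orbb => /(_ isT)/eqP.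
  have pS : psdmx S.
    by split=> // y; have := fZ 0 y; rewrite -/(bform _ _ _); lra.
  have [L SE] := IH S pS.
  exists (block_mx 0 0 0 L); rewrite tr_block_mx mulmx_block ZE ae w0.
  by rewrite !trmx0 !mulmx0 !mul0mx !addr0 add0r -SE raddf0.
have agt0 : 0 < a by rewrite lt_def an0.
have [L SE] := IH _ (psdmx_schur agt0 pB).
pose r := Num.sqrt a.
have rr : r * r = a by rewrite -expr2 sqr_sqrtr.
have rn0 : r != 0 by rewrite gt_eqF// sqrtr_gt0.
exists (block_mx r%:M 0 (r^-1 *: w) L).
rewrite tr_block_mx mulmx_block ZE tr_scalar_mx linearZ /= !trmx0.
rewrite !mulmx0 !mul0mx !addr0 -scalar_mxM rr mul_scalar_mx mul_mx_scalar.
rewrite !scalerA mulfV// !scale1r; congr block_mx.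
rewrite -SE -scalemxAl -scalemxAr scalerA -invfM rr.
by rewrite addrC subrK.
Qed.

(** Writing [Z] as [L *m L^T] turns the trace into the sum of the form of [A] over the columns of
    [L]. *)
Lemma mxinner_ge0 (R : realType) (n : nat) (A Z : 'M[R]_n) :
  psdmx A -> psdmx Z -> 0 <= mxinner A Z.
Proof.
move=> [sA pA] /psdmx_cholesky[L ->].
rewrite /mxinner sA mulmxA mxtrace_mulC mulmxA; apply: sumr_ge0 => i _.
have := pA (col i L); congr (0 <= _).
rewrite tr_col -row_mul [LHS]mxE [RHS]mxE; apply: eq_bigr => k _.
by congr (_ * _); rewrite mxE.
Qed.

Lemma mxinnerDl (R : realType) (n : nat) (A B Z : 'M[R]_n) :
  mxinner (A + B) Z = mxinner A Z + mxinner B Z.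
Proof. by rewrite /mxinner linearD /= mulmxDl mxtraceD. Qed.

Lemma mxinnerDr (R : realType) (n : nat) (A Z T : 'M[R]_n) :
  mxinner A (Z + T) = mxinner A Z + mxinner A T.
Proof. by rewrite /mxinner mulmxDr mxtraceD. Qed.

Lemma mxinnerZl (R : realType) (n : nat) a (A Z : 'M[R]_n) :
  mxinner (a *: A) Z = a * mxinner A Z.
Proof. by rewrite /mxinner linearZ /= -scalemxAl mxtraceZ. Qed.

Lemma mxinnerZr (R : realType) (n : nat) a (A Z : 'M[R]_n) :
  mxinner A (a *: Z) = a * mxinner A Z.
Proof. by rewrite /mxinner -scalemxAr mxtraceZ. Qed.

Lemma mxinner0r (R : realType) (n : nat) (A : 'M[R]_n) : mxinner A 0 = 0.
Proof. by rewrite /mxinner mulmx0 mxtrace0. Qed.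

Lemma mxinner_suml (R : realType) (n : nat) I (r : seq I) (F : I -> 'M[R]_n)
    (Z : 'M[R]_n) :
  mxinner (\sum_(i <- r) F i) Z = \sum_(i <- r) mxinner (F i) Z.
Proof.
elim/big_rec2: _ => [|i a A _ <-]; last by rewrite mxinnerDl.
by rewrite /mxinner trmx0 mul0mx mxtrace0.
Qed.

(** Isolates the error of the lifting: it depends only on [X - x *m x^T], the Schur complement of
    the lifted matrix. *)
Lemma mxinner_quad (R : realType) (n : nat) (q : quadratic R n)
    (x : 'cV[R]_n) (X : 'M[R]_n) :
  mxinner (quad_mx q) (block_mx 1%:M x^T x X) =
  quad_eval q x + mxinner (quadA q) (X - x *m x^T).
Proof.
rewrite -scaleN1r mxinnerDr mxinnerZr.
rewrite /mxinner /quad_mx tr_block_mx mulmx_block mxtrace_block.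
rewrite !mxtraceD trmxK tr_scalar_mx quadA_sym mul_scalar_mx.
rewrite (mxtrace_mulC (quadb q)) !mulmxA (mxtrace_mulC (_ *m x)) mulmxA.
rewrite !trace_mx11 /quad_eval.
have -> : x^T *m quadb q = ((quadb q)^T *m x)^T by rewrite trmx_mul trmxK.
have -> : (quadc q *: 1%:M : 'M_1) 0 0 = quadc q by rewrite !mxE mulr1.
have -> : ((quadb q)^T *m x)^T 0 0 = ((quadb q)^T *m x) 0 0 by rewrite mxE.
ring.
Qed.

(** * Dimension counts *)

Section SubspaceDim.
Context {R : realType} {V : vectType R}.
Implicit Types U W : set V.

Lemma subspace_dim_attained U :
  exists s : (subspace_dim U).-tuple V, free s /\ forall v, v \in s -> U v.
Proof.
rewrite /subspace_dim; elim/big_ind: _ => [|i j Pi Pj|k /asboolP//].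
  by exists [tuple]; split=> //; rewrite /free span_nil dimv0.
by case: (leqP i j).
Qed.

Lemma subspace_dim_maximal U (s : (subspace_dim U).-tuple V) :
  free s -> (forall v, v \in s -> U v) -> forall v, U v -> v \in <<s>>%VS.
Proof.
move=> fs sU v Uv; apply: contraT => vs.
have fvs : free (cons_tuple v s) by rewrite free_cons vs.
have le : ((subspace_dim U).+1 < (\dim {:V}).+1)%N.
  rewrite ltnS -[X in (X <= _)%N](size_tuple (cons_tuple v s)) -(eqP fvs).
  by rewrite dimvS ?subvf.
suff : ((subspace_dim U).+1 <= subspace_dim U)%N by rewrite ltnn.
apply: (@leq_bigmax_cond _ _ _ (Ordinal le)); apply/asboolP => /=.
exists (cons_tuple v s); split=> // w; rewrite inE => /orP[/eqP->//|].
exact: sU.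
Qed.

End SubspaceDim.

(** The matrix of products between maximal free families of [U] and [W] has more rows than columns;
    a nonzero vector in its left kernel gives the coefficients of [v]. *)
Lemma subspace_dim_orthogonal (R : realType) (n : nat) (U W : set 'cV[R]_n) :
  U 0 -> (forall a u v, U u -> U v -> U (a *: u + v)) ->
  (subspace_dim W < subspace_dim U)%N ->
  exists v, [/\ U v, v != 0 & forall w, W w -> (w^T *m v) 0 0 = 0].
Proof.
move=> U0 Ulin WU.
have [u [fu uU]] := subspace_dim_attained U.
have [s [fs sW]] := subspace_dim_attained W.
pose G := \matrix_(i < subspace_dim U, j < subspace_dim W)
  ((s`_j)^T *m u`_i) 0 0.
have : kermx G != 0.
  rewrite kermx_eq0 /row_free neq_ltn; apply/orP; left.
  exact: leq_ltn_trans (rank_leq_col _) WU.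
move=> /rowV0Pn[c /sub_kermxP cG c0].
exists (\sum_i c 0 i *: u`_i); split.
- rewrite -[X in U X]/(\sum_(i < _ | true) _).
  elim/big_rec: _ => // i x _; apply: Ulin.
  by apply: uU; rewrite mem_nth ?size_tuple.
- apply: contra c0 => /eqP cu; apply/eqP/rowP => i; rewrite mxE.
  by move/freeP: fu => /(_ _ cu).
move=> w /(subspace_dim_maximal fs sW) ws.
rewrite (coord_span ws) [(\sum_i _)^T]linear_sum mulmx_suml summxE.
rewrite big1// => j _.
rewrite linearZ /= -scalemxAl mxE; apply/eqP; rewrite mulf_eq0; apply/orP.
right; apply/eqP; rewrite mulmx_sumr summxE.
have : (c *m G) 0 j = 0 by rewrite cG mxE.
rewrite mxE => cGj; rewrite -[RHS]cGj; apply: eq_bigr => i _.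
by rewrite -scalemxAr !mxE.
Qed.

(** * Convex parabolas on a half line *)

Lemma parabola_le0 (R : realFieldType) (a b c s t : R) :
  0 <= a -> c <= 0 -> 0 <= t <= s -> c + b * s + a * s ^+ 2 <= 0 ->
  c + b * t + a * t ^+ 2 <= 0.
Proof.
move=> a0 c0 /andP[t0 ts] fs.
have [s0|s0] := leP s 0.
  by have -> : t = s by lra.
rewrite -(pmulr_rle0 _ s0).
(* The chord between 0 and [s], minus the convexity gap. *)
have -> : s * (c + b * t + a * t ^+ 2) = (s - t) * c +
  t * (c + b * s + a * s ^+ 2) - a * t * s * (s - t) by ring.
have : (s - t) * c <= 0 by apply: mulr_ge0_le0 => //; lra.
have : t * (c + b * s + a * s ^+ 2) <= 0 by exact: mulr_ge0_le0.
have : 0 <= a * t * s * (s - t) by rewrite !mulr_ge0//; lra.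
lra.
Qed.

(** Each parabola that is nonnegative at [B] has a root in [(0, B]]. At the smallest of the chosen
    roots no parabola is positive, by convexity. *)
Lemma parabola_first_root (R : realType) (I : finType) (P : pred I)
    (a b c : I -> R) (i0 : I) (B : R) :
  (forall i, P i -> 0 <= a i) -> (forall i, P i -> c i < 0) ->
  P i0 -> 0 <= B -> 0 <= c i0 + b i0 * B + a i0 * B ^+ 2 ->
  exists2 t, 0 < t &
    (forall i, P i -> c i + b i * t + a i * t ^+ 2 <= 0) /\
    exists2 i, P i & c i + b i * t + a i * t ^+ 2 = 0.
Proof.
move=> a0 c0 Pi0 B0 hB.
pose Q i := P i && (0 <= c i + b i * B + a i * B ^+ 2).
have root_ex i : exists r, Q i ->
    [/\ 0 < r, r <= B & c i + b i * r + a i * r ^+ 2 = 0].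
  (* The value 0 is a dummy for indices outside [Q], needed for [choice]. *)
  have [/andP[Pi iB]|] := boolP (Q i); last by exists 0.
  pose p := (c i)%:P + (b i)%:P * 'X + (a i)%:P * 'X^2.
  have pE t : p.[t] = c i + b i * t + a i * t ^+ 2 by rewrite !hornerE.
  have [|r] := @poly_ivt _ p 0 B B0.
    by rewrite !pE iB andbT mulr0 expr0n mulr0 !addr0 ltW ?c0.
  move=> /andP[r0 rB] /rootP; rewrite pE => pr.
  exists r => _; split=> //; rewrite lt_def r0 andbT.
  apply/eqP => r00; have := c0 i Pi.
  by rewrite -pr r00 mulr0 expr0n mulr0 !addr0 ltxx.
have [r rP] := choice root_ex.
have Qi0 : Q i0 by rewrite /Q Pi0.
case: (@arg_minP _ _ _ i0 Q r Qi0) => k Qk kmin.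
have [rk0 rkB rkE] := rP k Qk.
exists (r k) => //; split; last by exists k => //; case/andP: Qk.
move=> i Pi; have [Qi|] := boolP (Q i).
  have [_ _ riE] := rP i Qi.
  apply: (parabola_le0 (s := r i)); rewrite ?a0 ?(ltW (c0 _ _)) ?riE//.
  by rewrite (ltW rk0) kmin.
rewrite /Q Pi -ltNge => /ltW iB.
by apply: (parabola_le0 (s := B)); rewrite ?a0 ?(ltW (c0 _ _)) ?(ltW rk0).
Qed.

Lemma parabola_pos (R : realFieldType) (a b c : R) : 0 < a ->
  exists2 B, 0 <= B & 0 < c + b * B + a * B ^+ 2.
Proof.
move=> a0; have B0 : 0 <= (`|b| + `|c|) / a.
  by rewrite divr_ge0 ?addr_ge0// ltW.
exists ((`|b| + `|c|) / a + 1); first by rewrite addr_ge0.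
(* The witness [B] satisfies [a * B = |b| + |c| + a], so the quadratic term absorbs the two
   others. *)
have -> : c + b * ((`|b| + `|c|) / a + 1) + a * ((`|b| + `|c|) / a + 1) ^+ 2 =
    c + `|c| + (b + `|b|) * ((`|b| + `|c|) / a + 1) +
    `|c| * ((`|b| + `|c|) / a) + a * ((`|b| + `|c|) / a + 1).
  by field; rewrite gt_eqF.
have bb : 0 <= b + `|b| by have := ler_norm (- b); rewrite normrN; lra.
have cc : 0 <= c + `|c| by have := ler_norm (- c); rewrite normrN; lra.
apply: ltr_wpDl; last by rewrite mulr_gt0// ltr_wpDl.
apply: addr_ge0; last exact: mulr_ge0.
apply: addr_ge0 => //; apply: mulr_ge0 => //; exact: addr_ge0.
Qed.

(** * Generators of the cone over a polyhedron *)

Section Homogenization.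
Context {R : realType} {n k : nat}.
Variables (M : 'M[R]_(k, n)) (d : 'cV[R]_k).

(** The index [None] encodes nonnegativity of the homogenizing coordinate. *)
Definition homog_ineq (i : option 'I_k) (z : 'cV[R]_n * R^o) : R^o :=
  if i is Some i then (M *m z.1) i 0 - d i 0 * z.2 else - z.2.

Lemma homog_ineq_is_scalar i : scalar (homog_ineq i).
Proof.
case: i => [i|] c [x a] [y b] /=; last by rewrite opprD mulrN.
rewrite mulmxDr -scalemxAr [(_ + _ : 'cV_k) _ _]mxE [(_ *: _ : 'cV_k) _ _]mxE.
rewrite mulrDr opprD addrACA mulrBr; congr (_ - _ + _).
exact: mulrCA.
Qed.

HB.instance Definition _ i := GRing.isLinear.Build R ('cV[R]_n * R^o)%type R^o
  *%R (homog_ineq i) (homog_ineq_is_scalar i).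

End Homogenization.

Lemma polyhedral_generators (R : realType) (n : nat) (C : set 'cV[R]_n) :
  polyhedral C ->
  exists (I : finType) (g : I -> 'cV[R]_n * R^o), (forall i, 0 <= (g i).2) /\
    forall z, 0 < z.2 -> in_cone g z <-> C (z.2^-1 *: z.1).
Proof.
move=> [k [M [d ->]]].
have [I [g gP]] := cone_polyhedral
  [seq (homog_ineq M d i : {scalar ('cV[R]_n * R^o)%type})
    | i <- enum {: option 'I_k}].
have gE z : in_cone g z <->
    (forall i, (M *m z.1) i 0 <= d i 0 * z.2) /\ 0 <= z.2.
  rewrite gP all_map; split=> [/allP zP|[zM z2]].
    have zi i : homog_ineq M d i z <= 0.
      by apply: zP; rewrite mem_enum.
    split=> [i|]; first by have := zi (Some i); rewrite /= subr_le0.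
    by have := zi None; rewrite /= oppr_le0.
  apply/allP => i _ /=.
  by case: i => [i|] /=; rewrite ?subr_le0// oppr_le0.
exists I, g; split=> [i|z z2]; first by have /gE[] := in_cone_gen g i.
have E i : ((M *m (z.2^-1 *: z.1)) i 0 <= d i 0) =
    ((M *m z.1) i 0 <= d i 0 * z.2).
  by rewrite -scalemxAr mxE ler_pdivrMl// mulrC.
rewrite gE; split=> [[zM _] i|zM]; first by rewrite E.
by split=> [i|]; [rewrite -E|exact: ltW].
Qed.

(** * The homogenized Lagrangian *)

Section Lagrangian.
Context {R : realType} {N mI mE : nat}.
Variables (q0 : quadratic R N) (q : 'I_(mI + mE) -> quadratic R N).
Implicit Types (z : 'cV[R]_(mI + mE) * R^o) (gamma : 'cV[R]_(mI + mE)).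
Implicit Types (x v : 'cV[R]_N) (t s a : R).

(** Homogenizing makes [homA], [homb] and [lagr] linear in [z], so they can be evaluated on
    generators, including those with last coordinate 0, which are recession directions. *)
Definition homA z : 'M[R]_N :=
  z.2 *: quadA q0 + \sum_i z.1 i 0 *: quadA (q i).

Definition homb z : 'cV[R]_N :=
  z.2 *: quadb q0 + \sum_i z.1 i 0 *: quadb (q i).

Definition lagr x t z : R :=
  z.2 * (quad_eval q0 x - 2 * t) + \sum_i z.1 i 0 * quad_eval (q i) x.

Lemma homA_dual gamma : homA (gamma, 1) = aggA q0 q gamma.
Proof. by rewrite /homA /= scale1r. Qed.

Lemma homb_dual gamma : homb (gamma, 1) = aggb q0 q gamma.
Proof. by rewrite /homb /= scale1r. Qed.

Lemma homAD z z' : homA (z + z') = homA z + homA z'.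
Proof.
rewrite /homA /= scalerDl addrACA -big_split; congr (_ + _).
by apply: eq_bigr => i _; rewrite mxE scalerDl.
Qed.

Lemma homAZ a z : homA (a *: z) = a *: homA z.
Proof.
rewrite /homA /= scalerDr scalerA scaler_sumr; congr (_ + _).
by apply: eq_bigr => i _; rewrite mxE scalerA.
Qed.

Lemma lagrD x t z z' : lagr x t (z + z') = lagr x t z + lagr x t z'.
Proof.
rewrite /lagr /= mulrDl addrACA -big_split; congr (_ + _).
by apply: eq_bigr => i _; rewrite mxE mulrDl.
Qed.

Lemma lagrZ x t a z : lagr x t (a *: z) = a * lagr x t z.
Proof.
rewrite /lagr [RHS]mulrDr mulrA mulr_sumr; congr (_ + _).
by apply: eq_bigr => i _; rewrite mxE mulrA.
Qed.

Lemma lagr_sum x t (I : finType) (c : I -> R)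
    (g : I -> 'cV[R]_(mI + mE) * R^o) :
  lagr x t (\sum_i c i *: g i) = \sum_i c i * lagr x t (g i).
Proof.
elim/big_rec2: _ => [|i y z _ <-]; last by rewrite lagrD lagrZ.
by rewrite -(scale0r 0) lagrZ mul0r.
Qed.

Lemma lagr_shift x t s z : lagr x s z = lagr x t z - 2 * z.2 * (s - t).
Proof. by rewrite /lagr; ring. Qed.

Lemma quad_eval_line (p : quadratic R N) x v a :
  quad_eval p (x + a *: v) = quad_eval p x +
    2 * a * (bform (quadA p) v x + ((quadb p)^T *m v) 0 0) +
    a ^+ 2 * bform (quadA p) v v.
Proof.
rewrite /quad_eval -/(bform _ _ _) bform_line ?quadA_sym//.
by rewrite mulmxDr -scalemxAr mxE [(_ *: _ : 'M_1) _ _]mxE /bform; ring.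
Qed.

(** Arranged as a polynomial in [a], to fit the lemmas on parabolas; the leading coefficient is
    nonnegative when [homA z] is semidefinite. *)
Lemma lagr_line x v t s a z :
  lagr (x + a *: v) (t + a * s) z = lagr x t z +
    2 * (bform (homA z) v x + ((homb z)^T *m v) 0 0 - z.2 * s) * a +
    bform (homA z) v v * a ^+ 2.
Proof.
rewrite /lagr quad_eval_line.
have -> : \sum_i z.1 i 0 * quad_eval (q i) (x + a *: v) =
    \sum_i z.1 i 0 * quad_eval (q i) x +
    2 * a * (\sum_i z.1 i 0 * bform (quadA (q i)) v x +
             \sum_i z.1 i 0 * ((quadb (q i))^T *m v) 0 0) +
    a ^+ 2 * \sum_i z.1 i 0 * bform (quadA (q i)) v v.
  rewrite -big_split /= !mulr_sumr -!big_split /=; apply: eq_bigr => i _.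
  by rewrite quad_eval_line; ring.
have fA y : bform (homA z) v y = z.2 * bform (quadA q0) v y +
    \sum_i z.1 i 0 * bform (quadA (q i)) v y.
  rewrite bform_addmx bform_scalemx bform_sum; congr (_ + _).
  by apply: eq_bigr => i _; rewrite bform_scalemx.
have fb : ((homb z)^T *m v) 0 0 = z.2 * ((quadb q0)^T *m v) 0 0 +
    \sum_i z.1 i 0 * ((quadb (q i))^T *m v) 0 0.
  rewrite linearD linearZ /= mulmxDl mxE -scalemxAl mxE; congr (_ + _).
  rewrite linear_sum mulmx_suml summxE; apply: eq_bigr => i _.
  by rewrite linearZ /= -scalemxAl mxE.
rewrite !fA fb; ring.
Qed.

Lemma homogenizeE z : 0 < z.2 -> z = z.2 *: (z.2^-1 *: z.1, 1 : R^o).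
Proof.
case: z => g tau /= t0; congr pair; last exact/esym/mulr1.
by rewrite /= scalerA mulfV ?scale1r// gt_eqF.
Qed.

Lemma lagr_normalize x t z : 0 < z.2 ->
  lagr x t z = z.2 * lagr x t (z.2^-1 *: z.1, 1).
Proof. by move=> z0; rewrite -lagrZ -homogenizeE. Qed.

End Lagrangian.

(** * The relaxation, the dual generators and the faces of maximizers *)

Section Tightness.
Context {R : realType} {N mI mE : nat}.
Variables (q0 : quadratic R N) (q : 'I_(mI + mE) -> quadratic R N).
Implicit Types (z : 'cV[R]_(mI + mE) * R^o) (gamma : 'cV[R]_(mI + mE)).
Implicit Types (x v : 'cV[R]_N) (t s a : R).

(** Weak duality: weighting the constraints on [Y] by [z] bounds the Lagrangian plus the pairing of
    [homA z] with [X - x *m x^T] by 0, and that pairing is nonnegative. *)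
Lemma sdp_epigraph_lagr_le0 x t z : sdp_epigraph q0 q (x, t) ->
  0 <= z.2 -> ineq_nonneg z.1 -> psdmx (homA q0 q z) -> lagr q0 q x t z <= 0.
Proof.
move=> [X [_ [pY Y0 YI YE]]] z0 zI pA; rewrite /= in pY Y0 YI YE.
have pZ : psdmx (X - x *m x^T).
  have := @psdmx_schur R N 1 x X ltr01; rewrite invr1 scale1r; exact.
have : lagr q0 q x t z + mxinner (homA q0 q z) (X - x *m x^T) <= 0.
  rewrite /lagr /homA mxinnerDl mxinnerZl mxinner_suml addrACA -mulrDr.
  rewrite -big_split /= big_split_ord /=.
  rewrite addrAC -mxinner_quad; rewrite -[leRHS]addr0; apply: lerD.
    by apply: mulr_ge0_le0 => //; rewrite subr_le0.
  rewrite [X in _ + X]big1 ?addr0 => [|j _]; last first.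
    by rewrite mxinnerZl -mulrDr -mxinner_quad YE mulr0.
  apply: sumr_le0 => i _; rewrite mxinnerZl -mulrDr -mxinner_quad.
  exact: mulr_ge0_le0.
apply: le_trans; rewrite lerDl; exact: mxinner_ge0.
Qed.

Lemma epigraph_sub_sdp : epigraph q0 q `<=` sdp_epigraph q0 q.
Proof.
move=> [x t] [/= q0x [qI qE]]; exists (x *m x^T); split.
  by rewrite trmx_mul trmxK.
have E p : mxinner (quad_mx p) (block_mx 1%:M x^T x (x *m x^T)) =
    quad_eval p x by rewrite mxinner_quad subrr mxinner0r addr0.
split=> [||i|j]; rewrite /= ?E//.
have YE : block_mx 1%:M x^T x (x *m x^T) =
    col_mx 1%:M x *m (col_mx 1%:M x)^T :> 'M_(1 + N).
  by rewrite tr_col_mx mul_col_row trmx1 !mul1mx mulmx1.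
rewrite YE; split=> [|y]; first by rewrite trmx_mul trmxK.
rewrite !mulmxA -mulmxA -[y in X in _ *m X]trmxK -trmx_mul.
by rewrite mxE big_ord1 [_^T 0 0]mxE -expr2 sqr_ge0.
Qed.

Lemma sdp_epigraph_convex :
  convex_set (sdp_epigraph q0 q : set (convex_lmodType ('cV[R]_N * R^o)%type)).
Proof.
apply/convex_setP => -[x1 t1] [x2 t2] a /andP[a0 a1].
move=> [X1 [sX1 [/= pY1 Y01 YI1 YE1]]] [X2 [sX2 [/= pY2 Y02 YI2 YE2]]].
have b0 : 0 < 1 - a by rewrite subr_gt0.
exists (a *: X1 + (1 - a) *: X2); split.
  by rewrite linearD !linearZ /= sX1 sX2.
have -> : block_mx 1%:M (a *: x1 + (1 - a) *: x2)^T (a *: x1 + (1 - a) *: x2)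
    (a *: X1 + (1 - a) *: X2) =
    a *: block_mx 1%:M x1^T x1 X1 + (1 - a) *: block_mx 1%:M x2^T x2 X2.
  rewrite !scale_block_mx add_block_mx linearD !linearZ /=.
  by rewrite -scalerDl [a + _]addrC subrK scale1r.
split=> [||i|j].
- by apply: psdmxD; apply: psdmxZ => //; exact: ltW.
- rewrite mxinnerDr !mxinnerZr [X in _ <= 2 * X]/(a * t1 + (1 - a) * t2).
  rewrite mulrDr !(mulrCA 2); apply: lerD; exact: ler_wpM2l (ltW _) _ _ _.
- rewrite mxinnerDr !mxinnerZr -[leRHS]addr0.
  by apply: lerD; apply: mulr_ge0_le0 => //; exact: ltW.
- by rewrite mxinnerDr !mxinnerZr YE1 YE2 !mulr0 addr0.
Qed.

Lemma dual_set_convex gamma gamma' a : 0 <= a <= 1 ->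
  dual_set q0 q gamma -> dual_set q0 q gamma' ->
  dual_set q0 q (a *: gamma + (1 - a) *: gamma').
Proof.
move=> /andP[a0 a1] [pA gI] [pA' gI']; split=> [|i]; last first.
  by rewrite !mxE addr_ge0// mulr_ge0 ?subr_ge0.
have E : (a *: gamma + (1 - a) *: gamma', 1 : R^o) =
    a *: (gamma, 1 : R^o) + (1 - a) *: (gamma', 1 : R^o).
  by congr pair; rewrite /= -scalerDl [a + _]addrC subrK scale1r.
rewrite -homA_dual E homAD !homAZ !homA_dual.
by apply: psdmxD; apply: psdmxZ; rewrite ?subr_ge0.
Qed.

(* [g] generates the cone over [Gamma * {1}], so the supremum over [Gamma] of
   the Lagrangian is replaced by finitely many convex quadratic functions. *)
Lemma dual_set_generators : dual_set q0 q !=set0 ->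
  polyhedral (dual_set q0 q) ->
  exists (I : finType) (g : I -> 'cV[R]_(mI + mE) * R^o),
    (forall i, [/\ 0 <= (g i).2, ineq_nonneg (g i).1 &
                   psdmx (homA q0 q (g i))]) /\
    forall z, 0 < z.2 -> in_cone g z <-> dual_set q0 q (z.2^-1 *: z.1).
Proof.
move=> [gs Ggs] /polyhedral_generators[I [g [g2 gP]]].
exists I, g; split=> // i.
(* Adding any multiple of [g i] to [(gs, 1)] stays in the cone, so [g i] inherits the sign and
   semidefiniteness conditions as a recession direction. *)
have ray s : 0 <= s ->
    exists2 c, 0 < c & dual_set q0 q (c^-1 *: (gs + s *: (g i).1)) /\
      c = 1 + s * (g i).2.
  move=> s0; have c0 : 0 < 1 + s * (g i).2.
    by rewrite ltr_wpDr// mulr_ge0.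
  exists (1 + s * (g i).2) => //; split=> //.
  have /gP : 0 < ((gs, 1 : R^o) + s *: g i).2 by [].
  case=> + _; apply; apply: in_coneD; last first.
    by apply: in_coneZ => //; exact: in_cone_gen.
  by apply/gP; rewrite ?ltr01//= invr1 scale1r.
split=> //.
  move=> j; apply: (@ge0_ray _ (gs (lshift mE j) 0)) => s /ray[c c0 [[_ gI] _]].
  have := gI j; rewrite !mxE pmulr_rge0// invr_gt0//.
apply: (@psdmx_ray _ _ (aggA q0 q gs)) => s /ray[c c0 [[pA _] cE]].
have -> : aggA q0 q gs + s *: homA q0 q (g i) =
    c *: aggA q0 q (c^-1 *: (gs + s *: (g i).1)).
  rewrite -!homA_dual -!homAZ -homAD; congr homA.
  have := @homogenizeE _ _ _ ((gs, 1 : R^o) + s *: g i).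
  by rewrite /= -[X in 0 < X]cE -[_ + _ *: (g i).2]cE; apply.
by apply: psdmxZ => //; exact: ltW.
Qed.

(* Positive definiteness is an open condition, so only the sign constraints
   restrict [gamma] locally, and maximality gives complementary slackness. *)
Lemma definite_maximizer_epigraph x t gamma :
  dual_set q0 q gamma -> pdmx (aggA q0 q gamma) ->
  (forall gamma', dual_set q0 q gamma' -> lagr q0 q x t (gamma', 1) <= 0) ->
  lagr q0 q x t (gamma, 1) = 0 -> epigraph q0 q (x, t).
Proof.
move=> [_ gI] pA max0 g0.
have slack (d : 'cV[R]_(mI + mE)) : ineq_nonneg (gamma + d) ->
    \sum_i d i 0 * quad_eval (q i) x <= 0.
  move=> dI; have sB : (homA q0 q (d, 0))^T = homA q0 q (d, 0).
    rewrite linearD linearZ /= quadA_sym linear_sum; congr (_ + _).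
    by apply: eq_bigr => i _; rewrite linearZ /= quadA_sym.
  have [e e0 eP] := pdmx_open pA sB.
  (* The cap 1 makes the new point a convex combination of [gamma] and [gamma + d], which preserves
     the sign constraints. *)
  have s0 : 0 < Num.min e 1 by rewrite lt_min e0 ltr01.
  have sE : (gamma + Num.min e 1 *: d, 1 : R^o) =
      (gamma, 1 : R^o) + Num.min e 1 *: (d, 0 : R^o).
    by congr pair; rewrite /= scaler0 addr0.
  have : dual_set q0 q (gamma + Num.min e 1 *: d).
    split=> [|i].
      rewrite -homA_dual sE homAD homAZ homA_dual; apply: eP.
      by rewrite ltW//= ge_min lexx.
    have := dI i; have := gI i; rewrite !mxE.
    have : Num.min e 1 <= 1 by rewrite ge_min lexx orbT.
    move: (gamma _ _) (d _ _) => p r; move: (Num.min e 1) s0 => s s0 s1 p0 pr.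
    have -> : p + s * r = (1 - s) * p + s * (p + r) by ring.
    by rewrite addr_ge0// mulr_ge0 ?subr_ge0// ltW.
  move/max0; rewrite sE lagrD g0 add0r lagrZ pmulr_rle0//.
  by rewrite /lagr /= mul0r add0r.
have one i b : ineq_nonneg (gamma + b *: delta_mx i 0) ->
    b * quad_eval (q i) x <= 0.
  move/slack; rewrite (bigD1 i)//= big1 => [|j /negPf ji].
    by rewrite !mxE !eqxx mulr1 addr0.
  by rewrite !mxE ji mulr0 mul0r.
split=> /=; last split=> [i|j].
(* The direction [- gamma] shows that the weighted constraints sum to a nonnegative number; as the
   Lagrangian is 0, the objective bound follows. *)
- have : \sum_i (- gamma) i 0 * quad_eval (q i) x <= 0.
    by apply: slack => i; rewrite subrr mxE.
  move: g0; rewrite /lagr /= mul1r.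
  under [X in _ -> X <= _ -> _]eq_bigr do rewrite mxE mulNr.
  by rewrite sumrN; lra.
- have := one (lshift mE i) 1; rewrite mul1r; apply=> j.
  by rewrite !mxE addr_ge0// mul1r ler0n.
- have eqI b : ineq_nonneg (gamma + b *: delta_mx (rshift mI j) 0).
    by move=> i; rewrite !mxE eq_lrshift mulr0 addr0.
  have := one _ _ (eqI 1); have := one _ _ (eqI (-1)).
  by rewrite mul1r mulN1r; lra.
Qed.

(** When the Lagrangian at [(x, t)] is nonpositive on Gamma, its zeros there are its maximizers as
    soon as one exists. *)
Definition maximizers x t : set 'cV[R]_(mI + mE) :=
  [set gamma | dual_set q0 q gamma /\ lagr q0 q x t (gamma, 1) = 0].

Lemma lagr_dual_conv x t gamma gamma' a :
  lagr q0 q x t (a *: gamma + (1 - a) *: gamma', 1) =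
  a * lagr q0 q x t (gamma, 1) + (1 - a) * lagr q0 q x t (gamma', 1).
Proof.
rewrite -!lagrZ -lagrD; congr (lagr _ _ _ _ (_, _)).
by rewrite /= -scalerDl [a + _]addrC subrK scale1r.
Qed.

(** The Lagrangian is affine in [gamma]: a proper convex combination of nonpositive values vanishes
    only if both values do. *)
Lemma maximizers_face x t :
  (forall gamma, dual_set q0 q gamma -> lagr q0 q x t (gamma, 1) <= 0) ->
  face (dual_set q0 q) (maximizers x t).
Proof.
move=> max0; split=> [|gamma []//|g g' a Gg Gg' /andP[a0 a1]].
  apply/convex_setP => g g' a /andP[a0 a1] [Gg g0] [Gg' g0']; split.
    by apply: dual_set_convex => //; rewrite !ltW.
  by rewrite lagr_dual_conv g0 g0' !mulr0 addr0.
move=> [_]; rewrite lagr_dual_conv => s0.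
have b0 : 0 < 1 - a by rewrite subr_gt0.
have h : a * lagr q0 q x t (g, 1) <= 0 by rewrite pmulr_rle0// max0.
have h' : (1 - a) * lagr q0 q x t (g', 1) <= 0 by rewrite pmulr_rle0// max0.
have e : a * lagr q0 q x t (g, 1) = 0 by lra.
have e' : (1 - a) * lagr q0 q x t (g', 1) = 0 by lra.
split; split=> //; apply/eqP.
  by move/eqP: e; rewrite mulf_eq0 gt_eqF.
by move/eqP: e'; rewrite mulf_eq0 gt_eqF.
Qed.

(** The kernel has larger dimension than the space of differences in the affine hull of the image of
    [b], so it contains a nonzero vector orthogonal to these differences. *)
Lemma face_direction (F : set 'cV[R]_(mI + mE)) : F !=set0 ->
  affdim (aggb q0 q @` F) + 1 <= (subspace_dim (common_kernel q0 q F))%:Z ->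
  exists2 v, common_kernel q0 q F v /\ v != 0 &
    forall g g', F g -> F g' ->
      ((aggb q0 q g)^T *m v) 0 0 = ((aggb q0 q g')^T *m v) 0 0.
Proof.
(* A point of [F] rules out the value -1 of [affdim]. *)
move=> [g0 Fg0]; rewrite /affdim; case: asboolP => [E|_].
  have : (aggb q0 q @` F) (aggb q0 q g0) by exists g0.
  by rewrite E.
rewrite -PoszD lez_nat addn1 => dimF.
have [||v [kv v0 vorth]] := subspace_dim_orthogonal _ _ dimF.
- by move=> g _; rewrite mulmx0.
- move=> a u w ku kw g Fg.
  by rewrite mulmxDr -scalemxAr ku// kw// scaler0 addr0.
exists v => // g g' Fg Fg'; apply/eqP; rewrite -subr_eq0.
have affF h : F h -> affine_hull (aggb q0 q @` F) (aggb q0 q h).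
  move=> Fh; exists 1, (fun=> 1), (fun=> aggb q0 q h).
  by rewrite !big_ord1 scale1r; split=> // _; exists h.
have := vorth (aggb q0 q g - aggb q0 q g').
rewrite linearB mulmxBl !mxE => -> //.
by exists (aggb q0 q g, aggb q0 q g') => //; split; exact: affF.
Qed.

(** * Induction on the number of inactive generators *)

Section Generators.
Variables (I : finType) (g : I -> 'cV[R]_(mI + mE) * R^o).
Variable gs : 'cV[R]_(mI + mE).
Hypothesis Ggs : dual_set q0 q gs.
Hypothesis gs_pd : pdmx (aggA q0 q gs).
Hypothesis g_pos : forall i, 0 <= (g i).2.
Hypothesis g_psd : forall i, psdmx (homA q0 q (g i)).
Hypothesis g_gen : forall z, 0 < z.2 ->
  in_cone g z <-> dual_set q0 q (z.2^-1 *: z.1).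
Hypothesis faces_large : forall F, semidefinite_face q0 q F ->
  affdim (aggb q0 q @` F) + 1 <= (subspace_dim (common_kernel q0 q F))%:Z.

Let dual_cone gamma : dual_set q0 q gamma -> in_cone g (gamma, 1).
Proof. by move=> Gg; apply/g_gen; rewrite ?ltr01//= invr1 scale1r. Qed.

Lemma lagr_dual_le0 x t gamma : (forall i, lagr q0 q x t (g i) <= 0) ->
  dual_set q0 q gamma -> lagr q0 q x t (gamma, 1) <= 0.
Proof.
move=> xt /dual_cone[c c0 ->]; rewrite lagr_sum; apply: sumr_le0 => i _.
exact: mulr_ge0_le0.
Qed.

(* Adding an active generator to a maximizer gives a multiple of a maximizer. *)
Lemma active_line x t x' t' : (forall i, lagr q0 q x t (g i) <= 0) ->
  maximizers x t !=set0 ->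
  (forall gamma, maximizers x t gamma -> lagr q0 q x' t' (gamma, 1) = 0) ->
  forall i, lagr q0 q x t (g i) = 0 -> lagr q0 q x' t' (g i) = 0.
Proof.
move=> xt [g0 [Gg0 max0]] line i gi0.
pose z := (g0, 1 : R^o) + g i.
have z0 : 0 < z.2 by rewrite ltr_wpDr.
have lz y r : lagr q0 q y r (g0, 1) + lagr q0 q y r (g i) =
    z.2 * lagr q0 q y r (z.2^-1 *: z.1, 1).
  by rewrite -lagr_normalize// lagrD.
have /line line_z : maximizers x t (z.2^-1 *: z.1).
  split.
    by apply/g_gen => //; apply: in_coneD (dual_cone Gg0) (in_cone_gen g i).
  apply/eqP; move/eqP: (lz x t).
  by rewrite max0 gi0 addr0 eq_sym mulf_eq0 gt_eqF.
by have := lz x' t'; rewrite line_z mulr0 line// add0r.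
Qed.

(** Along the line the Lagrangian at the definite [gs] is a strictly convex parabola, hence
    somewhere positive. Some generator is positive there too, necessarily an inactive one, and the
    first root among the inactive ones is the stopping point. *)
Lemma move_to_active x t v s : v != 0 ->
  (forall i, lagr q0 q x t (g i) <= 0) ->
  (forall i, lagr q0 q x t (g i) = 0 ->
     forall a, lagr q0 q (x + a *: v) (t + a * s) (g i) = 0) ->
  exists2 a, 0 < a &
    (forall i, lagr q0 q (x + a *: v) (t + a * s) (g i) <= 0) /\
    exists2 i, lagr q0 q x t (g i) != 0 &
               lagr q0 q (x + a *: v) (t + a * s) (g i) = 0.
Proof.
move=> v0 xt active.
have [B B0 B_pos] : exists2 B, 0 <= B &
    0 < lagr q0 q (x + B *: v) (t + B * s) (gs, 1).
  have [|B B0] := @parabola_pos _ (bform (homA q0 q (gs, 1)) v v)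
    (2 * (bform (homA q0 q (gs, 1)) v x +
          ((homb q0 q (gs, 1))^T *m v) 0 0 - 1 * s)) (lagr q0 q x t (gs, 1)).
    by rewrite homA_dual; case: gs_pd => _; apply.
  by move=> h; exists B => //; rewrite lagr_line.
have [i0 i0_pos] : exists i, 0 < lagr q0 q (x + B *: v) (t + B * s) (g i).
  apply: contrapT => /forallNP none; move: B_pos; rewrite ltNge => /negP; apply.
  by apply: lagr_dual_le0 => // i; rewrite leNgt; exact/negP/none.
have i0_inactive : lagr q0 q x t (g i0) != 0.
  by apply/eqP => /active/(_ B) E; rewrite E ltxx in i0_pos.
have [i _|i ix||||a a0 [a_le [i Pi ai0]]] := @parabola_first_root R I
    (fun i => lagr q0 q x t (g i) != 0)
    (fun i => bform (homA q0 q (g i)) v v)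
    (fun i => 2 * (bform (homA q0 q (g i)) v x +
      ((homb q0 q (g i))^T *m v) 0 0 - (g i).2 * s))
    (fun i => lagr q0 q x t (g i)) i0 B.
- by case: (g_psd i) => _; apply.
- by rewrite lt_neqAle ix xt.
- by [].
- by [].
- by rewrite -lagr_line ltW.
exists a => //; split=> [j|]; last by exists i; rewrite // lagr_line.
have [j0|jn0] := eqVneq (lagr q0 q x t (g j)) 0; first by rewrite active.
by rewrite lagr_line a_le.
Qed.

(** [C] is arbitrary because the hull is the intersection of all convex supersets of the
    epigraph. *)
Lemma lagr_convex_mem (C : set ('cV[R]_N * R^o)) x t :
  convex_set (C : set (convex_lmodType ('cV[R]_N * R^o)%type)) ->
  epigraph q0 q `<=` C ->
  (forall i, lagr q0 q x t (g i) <= 0) ->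
  (exists2 i, 0 < (g i).2 & lagr q0 q x t (g i) = 0) -> C (x, t).
Proof.
move=> cC DC; have [n] := ubnP #|[pred i | lagr q0 q x t (g i) != 0]|.
elim: n x t => // n IH x t; rewrite ltnS => card_n xt [i0 i00 i0t].
have max0 := @lagr_dual_le0 x t ^~ xt.
(* A positive last coordinate lets [g i0] be rescaled to a point of Gamma. *)
have Fne : maximizers x t !=set0.
  exists ((g i0).2^-1 *: (g i0).1); split.
    by apply/g_gen => //; exact: in_cone_gen.
  by move/eqP: i0t; rewrite lagr_normalize// mulf_eq0 gt_eqF// => /eqP.
have [[gamma [Gg g0] gpd]|semi] := pselect (definite q0 q (maximizers x t)).
  exact/DC/(definite_maximizer_epigraph Gg gpd).
have Fface := maximizers_face max0.
have [v [kv v0] vb] := face_direction Fne (faces_large (conj Fface semi)).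
have [g0 [Gg0 lg0]] := Fne.
(* With this slope the linear and quadratic coefficients along the line vanish for every
   maximizer. *)
pose s := ((aggb q0 q g0)^T *m v) 0 0.
have line a : forall i, lagr q0 q x t (g i) = 0 ->
    lagr q0 q (x + a *: v) (t + a * s) (g i) = 0.
  apply: active_line => // gamma [Gg lg].
  have Fg : maximizers x t gamma by [].
  rewrite lagr_line lg homA_dual homb_dual (vb _ g0)// -/s.
  have Av y : bform (aggA q0 q gamma) v y = 0.
    have [[sA _] _] := Gg.
    by rewrite bformC// /bform -mulmxA kv// mulmx0 mxE.
  by rewrite !Av /=; ring.
have step (w : 'cV[R]_N) r : w != 0 ->
    (forall i, lagr q0 q x t (g i) = 0 ->
      forall a, lagr q0 q (x + a *: w) (t + a * r) (g i) = 0) ->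
    exists2 a, 0 < a & C (x + a *: w, t + a * r).
  move=> w0 active; have [a a0 [a_le [i ix ai]]] := move_to_active w0 xt active.
  exists a => //; apply: IH => //; last by exists i0 => //; exact: active.
  apply: leq_trans card_n; apply: proper_card; apply/properP; split.
    by apply/fintype.subsetP => j; rewrite !inE; apply: contra => /eqP/active->.
  by exists i; rewrite !inE// ai eqxx.
have [i ix a|a a0 Ca] := step v s v0; first exact: line.
have [||b b0 Cb] := step (- v) (- s); first by rewrite oppr_eq0.
  move=> i ix b; have := line (- b) i ix.
  by rewrite scaleNr mulNr scalerN mulrN.
have ab : 0 < a + b by rewrite addr_gt0.
(* The weight for which the displacements [a] and [- b] average to 0. *)
have lam : 0 < b / (a + b) < 1.
  by rewrite divr_gt0// ltr_pdivrMr// mul1r ltrDr.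
have /convex_setP/(_ _ _ _ lam Ca Cb) := cC.
have E1 : b / (a + b) * a + (1 - b / (a + b)) * - b = 0.
  by field; rewrite gt_eqF.
have -> // : b / (a + b) *: (x + a *: v, t + a * s : R^o) +
  (1 - b / (a + b)) *: (x + b *: - v, t + b * - s : R^o) = (x, t : R^o).
congr pair => /=.
  rewrite !scalerDr addrACA -scalerDl [b / _ + _]addrC subrK scale1r.
  rewrite scalerN -scaleNr !scalerA -scalerDl.
  by rewrite E1 scale0r addr0.
rewrite mulrN -mulNr.
transitivity (t + (b / (a + b) * a + (1 - b / (a + b)) * - b) * s).
  by rewrite /GRing.scale /=; ring.
by rewrite E1 mul0r addr0.
Qed.

End Generators.

(* Lowering [t] until a generator with positive last coordinate is active. *)
Lemma sdp_epigraph_sub_convex (C : set ('cV[R]_N * R^o)) :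
  (exists2 gamma, dual_set q0 q gamma & pdmx (aggA q0 q gamma)) ->
  polyhedral (dual_set q0 q) ->
  (forall F, semidefinite_face q0 q F ->
    affdim (aggb q0 q @` F) + 1
      <= (subspace_dim (common_kernel q0 q F))%:Z) ->
  convex_set (C : set (convex_lmodType ('cV[R]_N * R^o)%type)) ->
  epigraph q0 q `<=` C -> sdp_epigraph q0 q `<=` C.
Proof.
move=> [gs Ggs gs_pd] poly faces cC DC [x t] xt.
have [I [g [g_prop g_gen]]] := dual_set_generators (ex_intro _ gs Ggs) poly.
have g_pos i : 0 <= (g i).2 by have [] := g_prop i.
have g_psd i : psdmx (homA q0 q (g i)) by have [] := g_prop i.
have lag i : lagr q0 q x t (g i) <= 0.
  by have [] := g_prop i => *; exact: sdp_epigraph_lagr_le0.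
(* Otherwise the cone could not contain [(gs, 1)]. *)
have [i1 i1_pos] : exists i, 0 < (g i).2.
  apply: contrapT => /forallNP none.
  have : in_cone g (gs, 1) by apply/g_gen; rewrite ?ltr01//= invr1 scale1r.
  move=> [c c0] /(congr1 snd) /=; rewrite raddf_sum big1 => [/eqP|i _ /=].
    by rewrite oner_eq0.
  have -> : (g i).2 = 0; last exact: scaler0.
  by apply/le_anti; rewrite g_pos andbT leNgt; exact/negP/none.
(* The height at which generator [i] becomes active; the largest one is the lowest height admissible
   for all generators. *)
pose u i := t + lagr q0 q x t (g i) / (2 * (g i).2).
have uE i : 0 < (g i).2 -> forall r,
    lagr q0 q x r (g i) = 2 * (g i).2 * (u i - r).
  move=> gi r; rewrite (lagr_shift _ _ _ t) /u; field.
  by rewrite gt_eqF.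
case: (@arg_maxP _ _ _ i1 (fun i => 0 < (g i).2) u i1_pos) => i0 i0_pos u_max.
have u_le : u i0 <= t.
  rewrite /u gerDl; apply: mulr_le0_ge0 => //.
  by rewrite invr_ge0 mulr_ge0.
(* Shifting [C] down by [t - u i0 >= 0] undoes the lowering; the shifted set still contains the
   epigraph, which is closed upward. *)
pose C' := [set p : 'cV[R]_N * R^o | C (p + (0, t - u i0 : R^o))].
suff : C' (x, u i0).
  by rewrite /C' /=; congr C; congr pair; rewrite /= ?addr0// addrC subrK.
apply: (@lagr_convex_mem I g gs) => //.
- apply/convex_setP => p p' a a01 Cp Cp'; rewrite /C' /=.
  have /convex_setP/(_ _ _ _ a01 Cp Cp') := cC.
  rewrite !scalerDr addrACA -scalerDl [a + _]addrC subrK scale1r; exact.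
- move=> [y r] [/= yr fy]; apply: DC; split=> /=; last by rewrite addr0.
  rewrite addr0; apply: le_trans yr _; rewrite ler_pM2l// lerDl subr_ge0//.
- move=> i; have [gi0|gin0] := eqVneq ((g i).2 : R) 0.
    by rewrite (lagr_shift _ _ _ t) gi0 mulr0 mul0r subr0.
  have gi : 0 < (g i).2 by rewrite lt_def gin0 g_pos.
  rewrite uE//; apply: mulr_ge0_le0; first by rewrite mulr_ge0.
  by rewrite subr_le0; exact: u_max.
- by exists i0 => //; rewrite uE// subrr mulr0.
Qed.

End Tightness.

Theorem theorem1 (R : realType) (N mI mE : nat)
    (hN : (1 <= N)%N) (hm : (1 <= mI + mE)%N)
    (q0 : quadratic R N) (q : 'I_(mI + mE) -> quadratic R N)
    (hfeas : feasible q !=set0)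
    (hdual : exists gamma : 'cV[R]_(mI + mE),
       ineq_nonneg gamma /\ pdmx (aggA q0 q gamma))
    (hpoly : polyhedral (dual_set q0 q))
    (hfaces : forall F : set 'cV[R]_(mI + mE), semidefinite_face q0 q F ->
       affdim (aggb q0 q @` F) + 1
         <= (subspace_dim (common_kernel q0 q F))%:Z) :
  convex_hull (epigraph q0 q) = sdp_epigraph q0 q.
Proof.
apply/seteqP; split.
  apply: smallest_sub; [exact: sdp_epigraph_convex|exact: epigraph_sub_sdp].
move=> p sp C [cC DC].
have [gamma [gI gpd]] := hdual.
apply: (sdp_epigraph_sub_convex _ hpoly hfaces cC DC sp).
by exists gamma => //; split=> //; exact: pdmxW.
Qed.
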